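(* Let $A$ be either $\mathbb{Z}$ or a discrete valuation ring of mixed characteristic. Let $R$ be an essentially smooth $A$-algebra. If $Q \in \mathrm{Spec}(R)$ is such that $Q \cap A = (0)$, then $Q^{(n)}=Q^{\langle n\rangle_A}$ for all $n\ge 1$.
   Context: All rings are commutative with identity. A ring $S$ is essentially smooth over a subring $B$ if the inclusion $B\to S$ is formally smooth and $S$ is a localization of a finitely generated $B$-algebra. For a prime ideal $Q$ of a ring $R$ and $n\ge 1$, the $n$-th symbolic power of $Q$ is $Q^{(n)} = Q^nR_Q\cap R$ (the preimage of $Q^nR_Q$ under $R\to R_Q$). For a ring map $B\to S$, the sets of $B$-linear differential operators on $S$ of order at most $n$ are defined inductively: $D^0_{S|B}=\mathrm{Hom}_S(S,S)\subseteq \mathrm{Hom}_B(S,S)$ (multiplications by elements of $S$), and for $n\ge 1$, $D^n_{S|B}=\{\partial\in \mathrm{Hom}_B(S,S) \mid [\partial,f]=\partial\circ f-f\circ\partial\in D^{n-1}_{S|B} \text{ for all } f\in D^0_{S|B}\}$. For an ideal $I$ of $S$, with $B$ a subring of $S$, and $n\ge 1$, the $n$-th ($B$-linear) differential power of $I$ is $I^{\langle n\rangle_B}=\{f\in S\mid \partial(f)\in I \text{ for all } \partial\in D^{n-1}_{S|B}\}$. *)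

(* Defs.v *)
From HB Require Import structures.
From mathcomp Require Import all_boot all_order all_algebra ring.
From mathcomp Require Import boolp classical_sets.

Set Implicit Arguments.
Unset Strict Implicit.
Unset Printing Implicit Defensive.

Import GRing.Theory.
Local Open Scope classical_set_scope.
Local Open Scope ring_scope.
Local Open Scope quotient_scope.

(* The localization W^-1 R, as the quotient of R * W by
   (a, s) ~ (b, t) <-> exists w in W, w * (a * t) = w * (b * s). *)
Section Localization.
Variables (R : comPzRingType) (W : mulrClosed R).

Definition loc_rep : Type := (R * {s : R | s \in W})%type.
HB.instance Definition _ := Choice.on loc_rep.

Implicit Types x y z : loc_rep.

Definition loc_den x : R := val x.2.

Lemma loc_denP x : loc_den x \in W.
Proof. exact: valP x.2. Qed.

Definition mk_rep (a s : R) (sW : s \in W) : loc_rep :=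
  (a, exist (fun s : R => s \in W) s sW).

Definition loc_equiv x y : bool :=
  `[< exists2 w, w \in W & w * (x.1 * loc_den y) = w * (y.1 * loc_den x) >].

Lemma loc_equivP x y :
  reflect (exists2 w, w \in W & w * (x.1 * loc_den y) = w * (y.1 * loc_den x))
          (loc_equiv x y).
Proof. exact: asboolP. Qed.

Lemma loc_equiv_is_equiv : equiv_class_of loc_equiv.
Proof.
split=> [x|x y|y x z].
- by apply/loc_equivP; exists 1; rewrite ?rpred1.
- by apply/loc_equivP/loc_equivP => -[w wW e]; exists w.
move=> /loc_equivP[w wW e] /loc_equivP[v vW f]; apply/loc_equivP.
exists (w * v * loc_den y); first by rewrite !rpredM ?loc_denP.
transitivity (v * loc_den z * (w * (x.1 * loc_den y))); first by ring.
transitivity (w * loc_den x * (v * (y.1 * loc_den z))).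
  by rewrite e; ring.
by rewrite f; ring.
Qed.

Canonical loc_equiv_equiv := EquivRelPack loc_equiv_is_equiv.
Canonical loc_equiv_encModRel := defaultEncModRel loc_equiv.

Definition localization : Type := {eq_quot loc_equiv}.
HB.instance Definition _ : EqQuotient loc_rep loc_equiv localization :=
  EqQuotient.on localization.
HB.instance Definition _ := Choice.on localization.

Definition rep0 : loc_rep := mk_rep 0 (rpred1 W).
Definition rep1 : loc_rep := mk_rep 1 (rpred1 W).
Definition repN x : loc_rep := mk_rep (- x.1) (loc_denP x).
Definition repD x y : loc_rep :=
  mk_rep (x.1 * loc_den y + y.1 * loc_den x) (rpredM (loc_denP x) (loc_denP y)).
Definition repM x y : loc_rep :=
  mk_rep (x.1 * y.1) (rpredM (loc_denP x) (loc_denP y)).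

Let locS : (forall x y, loc_den (repD x y) = loc_den x * loc_den y) *
  (forall x y, loc_den (repM x y) = loc_den x * loc_den y) *
  (forall x, loc_den (repN x) = loc_den x) *
  (loc_den rep0 = 1) * (loc_den rep1 = 1) *
  (forall a (s : R) (sW : s \in W), loc_den (mk_rep a sW) = s).
Proof. by []. Qed.

Definition loc0 : localization := \pi_localization rep0.
Definition loc1 : localization := \pi_localization rep1.
Definition locN (u : localization) : localization :=
  \pi_localization (repN (repr u)).
Definition locD (u v : localization) : localization :=
  \pi_localization (repD (repr u) (repr v)).
Definition locM (u v : localization) : localization :=
  \pi_localization (repM (repr u) (repr v)).

Lemma loc_eqP x y :
  \pi_localization x = \pi_localization y <->
  exists2 w, w \in W & w * (x.1 * loc_den y) = w * (y.1 * loc_den x).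
Proof. by split=> [/eqmodP/loc_equivP|h]; last apply/eqmodP/loc_equivP. Qed.

Lemma loc_eq1 x y : x.1 * loc_den y = y.1 * loc_den x ->
  \pi_localization x = \pi_localization y.
Proof. by move=> e; apply/loc_eqP; exists 1; rewrite ?rpred1 // e. Qed.

Lemma reprE x : exists2 w, w \in W &
  w * ((repr (\pi_localization x)).1 * loc_den x) =
  w * (x.1 * loc_den (repr (\pi_localization x))).
Proof. by apply/loc_eqP; rewrite reprK. Qed.

Lemma locNE x : locN (\pi_localization x) = \pi_localization (repN x).
Proof.
have [w wW e] := reprE x; apply/loc_eqP; exists w => //=.
by rewrite !mulNr !mulrN e.
Qed.

Lemma locDE x y :
  locD (\pi_localization x) (\pi_localization y) =
  \pi_localization (repD x y).
Proof.
have [w wW e] := reprE x; have [v vW f] := reprE y.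
apply/loc_eqP; exists (w * v); rewrite ?rpredM //= !locS.
move: e f; set x' := repr _; set y' := repr _ => e f.
transitivity (v * loc_den y' * loc_den y * (w * (x'.1 * loc_den x)) +
              w * loc_den x' * loc_den x * (v * (y'.1 * loc_den y))).
  by ring.
by rewrite e f; ring.
Qed.

Lemma locME x y :
  locM (\pi_localization x) (\pi_localization y) =
  \pi_localization (repM x y).
Proof.
have [w wW e] := reprE x; have [v vW f] := reprE y.
apply/loc_eqP; exists (w * v); rewrite ?rpredM //= !locS.
move: e f; set x' := repr _; set y' := repr _ => e f.
transitivity ((w * (x'.1 * loc_den x)) * (v * (y'.1 * loc_den y))).
  by ring.
by rewrite e f; ring.
Qed.

Fact locDA : associative locD.
Proof.
elim/quotW=> x; elim/quotW=> y; elim/quotW=> z.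
rewrite (locDE y z) (locDE x y) !locDE.
by apply: loc_eq1; rewrite /= !locS; ring.
Qed.

Fact locDC : commutative locD.
Proof.
elim/quotW=> x; elim/quotW=> y; rewrite (locDE x y) (locDE y x).
by apply: loc_eq1; rewrite /= !locS; ring.
Qed.

Fact loc0D : left_id loc0 locD.
Proof.
elim/quotW=> x; rewrite /loc0 locDE.
by apply: loc_eq1; rewrite /= !locS; ring.
Qed.

Fact locND : left_inverse loc0 locN locD.
Proof.
elim/quotW=> x; rewrite /loc0 locNE locDE.
by apply: loc_eq1; rewrite /= !locS; ring.
Qed.

HB.instance Definition _ :=
  GRing.isZmodule.Build localization locDA locDC loc0D locND.

Fact locMA : associative locM.
Proof.
elim/quotW=> x; elim/quotW=> y; elim/quotW=> z.
rewrite (locME y z) (locME x y) !locME.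
by apply: loc_eq1; rewrite /= !locS; ring.
Qed.

Fact locMC : commutative locM.
Proof.
elim/quotW=> x; elim/quotW=> y; rewrite (locME x y) (locME y x).
by apply: loc_eq1; rewrite /= !locS; ring.
Qed.

Fact loc1M : left_id loc1 locM.
Proof.
elim/quotW=> x; rewrite /loc1 locME.
by apply: loc_eq1; rewrite /= !locS; ring.
Qed.

Fact locMDl : left_distributive locM locD.
Proof.
elim/quotW=> x; elim/quotW=> y; elim/quotW=> z.
rewrite (locDE x y) (locME x z) (locME y z) locME locDE.
by apply: loc_eq1; rewrite /= !locS; ring.
Qed.

HB.instance Definition _ :=
  GRing.Zmodule_isComPzRing.Build localization locMA locMC loc1M locMDl.

Definition to_loc (a : R) : localization :=
  \pi_localization (mk_rep a (rpred1 W)).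

Fact to_loc_is_zmod_morphism : zmod_morphism to_loc.
Proof.
move=> a b; apply/esym.
transitivity (locD (to_loc a) (locN (to_loc b))) => //.
by rewrite /to_loc locNE locDE; apply: loc_eq1; rewrite /= !locS; ring.
Qed.

Fact to_loc_is_monoid_morphism : monoid_morphism to_loc.
Proof.
split=> [//|a b]; apply/esym.
transitivity (locM (to_loc a) (to_loc b)) => //.
by rewrite /to_loc locME; apply: loc_eq1; rewrite /= !locS; ring.
Qed.

HB.instance Definition _ :=
  GRing.isZmodMorphism.Build R localization to_loc to_loc_is_zmod_morphism.
HB.instance Definition _ :=
  GRing.isMonoidMorphism.Build R localization to_loc to_loc_is_monoid_morphism.

End Localization.

(* Ideals as subsets; contrary to the [idealr] of the library, the improper
   ideal is allowed. *)
Definition is_ideal (R : pzRingType) (I : set R) : Prop :=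
  I 0 /\ forall a x y, I x -> I y -> I (a * x + y).

Definition ideal_gen (R : pzRingType) (X : set R) : set R :=
  smallest (@is_ideal R) X.

Definition ideal_mul (R : pzRingType) (I J : set R) : set R :=
  ideal_gen [set x * y | x in I & y in J].

Definition ideal_exp (R : pzRingType) (I : set R) (n : nat) : set R :=
  iter n (ideal_mul I) setT.

Definition prime_compl (R : comNzRingType) (Q : prime_idealr R) : {pred R} :=
  [pred s | s \notin Q].

Fact prime_compl_mulr_closed (R : comNzRingType) (Q : prime_idealr R) :
  GRing.mulr_closed (prime_compl Q).
Proof.
split=> [|x y]; first by rewrite inE idealr1.
by rewrite !inE prime_idealrM negb_or => -> ->.
Qed.

HB.instance Definition _ (R : comNzRingType) (Q : prime_idealr R) :=
  GRing.isMulClosed.Build R (prime_compl Q) (prime_compl_mulr_closed Q).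

Definition symbolic_power (R : comNzRingType) (Q : prime_idealr R) (n : nat) :
    set R :=
  let loc : R -> localization (prime_compl Q) := @to_loc R (prime_compl Q) in
  loc @^-1` ideal_gen (loc @` ideal_exp [set x | x \in Q] n).

Fixpoint diff_op (B : pzRingType) (S : comAlgType B) (n : nat) (d : S -> S) :
    Prop :=
  match n with
  | 0 => exists f : S, forall x, d x = f * x
  | m.+1 => linear d /\ forall f : S, diff_op m (fun x => d (f * x) - f * d x)
  end.

(* Only meaningful for n >= 1. *)
Definition diff_power (B : pzRingType) (S : comAlgType B) (I : set S)
    (n : nat) : set S :=
  [set f | forall d : S -> S, diff_op n.-1 d -> I (d f)].

(* pi presents D as the quotient of C by the square-zero ideal ker pi.  The
   types [comAlgType] exclude the zero algebra, which loses nothing: C is zero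
   as soon as D is, and then every lift exists. *)
Definition formally_smooth (B : comPzRingType) (S : comAlgType B) : Prop :=
  forall (C D : comAlgType B) (pi : {lrmorphism C -> D}),
    (forall y, exists x, pi x = y) ->
    (forall x y, pi x = 0 -> pi y = 0 -> x * y = 0) ->
    forall g : {lrmorphism S -> D},
      exists h : {lrmorphism S -> C}, forall x, pi (h x) = g x.

Definition fin_gen_alg (B : comPzRingType) (C : comAlgType B) : Prop :=
  exists s : seq C,
    forall P : subalgClosed C, {subset s <= P} -> forall x, x \in P.

(* S is isomorphic to W^-1 C as a B-algebra. *)
Definition localization_of (B : comPzRingType) (C S : comAlgType B)
    (W : mulrClosed C) : Prop :=
  exists2 g : {rmorphism localization W -> S},
    bijective g & forall b : B, g (to_loc W b%:A) = b%:A.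

(* The injectivity clause says that B is a subring of S. *)
Definition essentially_smooth (B : comPzRingType) (S : comAlgType B) : Prop :=
  [/\ injective (fun b : B => b%:A : S),
      formally_smooth S
    & exists (C : comAlgType B) (W : mulrClosed C),
        fin_gen_alg C /\ localization_of S W].

Definition maximal_ideal (A : nzRingType) (m : idealr A) : Prop :=
  forall J : idealr A, {subset m <= J} -> J =i m.

(* Only proper ideals need to be mentioned: the unit ideal is principal. *)
Definition principal_ideal_domain (A : idomainType) : Prop :=
  forall I : idealr A, exists a : A, forall x,
    x \in I <-> exists b, x = b * a.

(* A local principal ideal domain with maximal ideal m <> 0. *)
Definition dvr (A : idomainType) (m : idealr A) : Prop :=
  [/\ principal_ideal_domain A,
      maximal_ideal m,
      forall m' : idealr A, maximal_ideal m' -> m' =i m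
    & exists2 a, a \in m & a != 0].

Definition mixed_characteristic_dvr (A : idomainType) : Prop :=
  exists m : idealr A,
    [/\ dvr m, [pchar A] =i pred0 & exists p, p \in [pchar {ideal_quot m}]].

Definition isomorphic_to_Z (A : pzRingType) : Prop :=
  exists f : {rmorphism int -> A}, bijective f.

(* Main.v *)
Require Import Defs.
From HB Require Import structures.
From mathcomp Require Import all_boot all_order all_algebra ring.
From mathcomp Require Import boolp classical_sets.
Set Implicit Arguments.
Unset Strict Implicit.
Unset Printing Implicit Defensive.
Import GRing.Theory.
Local Open Scope classical_set_scope.
Local Open Scope ring_scope.

(** Since Q is prime, Q^(n) consists of the f with t * f in Q^n for some t
outside Q ([symbolic_powerE]).  The inclusion of Q^(n) in the differential
power is formal: an operator of order at most n - 1 maps Q^n into Q, because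
commuting it past a factor in Q lowers its order, and the denominators t are
removed by induction on the order ([diff_op_sat_power]).

For the converse, no positive integer vanishes in A, and Q meets A in 0, so no
positive integer lies in Q.  Suppose that there is an Euler field at Q, that is
a combination E = sum_i y_i * D_i of A-linear derivations D_i of R with all y_i
in Q, which acts on Q modulo Q^(2) as multiplication by some s outside Q.  By the Leibniz
rule, E then acts on Q^(m) modulo Q^(m+1) as multiplication by m * s
([euler_sat_power]), like the Euler operator on homogeneous polynomials.  If f
is killed into Q by all operators of order at most n, then by induction f and
every D_i f lie in Q^(n), so E f lies in Q^(n+1), hence n * s * f does, hence f
does ([diff_power_sub_sat_power]).

It remains to find an Euler field.  R is a ring of fractions of the image of a
polynomial ring P over A, and Q pulls back to a prime of P that meets A in 0.
On P an Euler field is built by adjoining one variable at a time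
([euler_poly]): the step is trivial if the prime of B[X] is extended from B;
otherwise, up to elements outside the prime, it is generated by the extension
from B and one polynomial g, whose derivative is not in the prime since the
characteristic is 0, so a multiple of d/dX corrects the behaviour at g.

Formal smoothness carries the derivations d_i of P occurring in that field down
to R ([descend_derivations]).  In the trivial extension of R by R^k, consider
the fractions of the elements (p, d_1 p, ..., d_k p) with p in P.  They form a
subring whose projection to R is onto with square-zero kernel; a section of this
projection has the form r |-> (r, D_1 r, ..., D_k r) with derivations D_i of R
that agree with the d_i on suitable representatives, and these turn the
Euler field of P into one of R ([euler_descend]). *)

(** * Powers of ideals and their saturations *)

Arguments ideal_exp : simpl never.

Section IdealPowers.
Variable R : comPzRingType.
Implicit Types I J : set R.

Lemma is_ideal0 I : is_ideal I -> I 0. Proof. by case. Qed.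

Lemma is_idealMl I a x : is_ideal I -> I x -> I (a * x).
Proof. by case=> I0 IP Ix; rewrite -[a * x]addr0; apply: IP. Qed.

Lemma is_idealMr I a x : is_ideal I -> I x -> I (x * a).
Proof. by rewrite mulrC; apply: is_idealMl. Qed.

Lemma is_idealD I x y : is_ideal I -> I x -> I y -> I (x + y).
Proof. by case=> I0 IP Ix Iy; rewrite -[x]mul1r; apply: IP. Qed.

Lemma is_idealB I x y : is_ideal I -> I x -> I y -> I (x - y).
Proof.
by move=> idI Ix Iy; apply: is_idealD => //; rewrite -mulN1r; apply: is_idealMl.
Qed.

Lemma is_ideal_sum I (T : Type) (r : seq T) (P : pred T) (F : T -> R) :
  is_ideal I -> (forall i, P i -> I (F i)) -> I (\sum_(i <- r | P i) F i).
Proof.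
move=> idI IF; elim/big_ind: _ => //; first exact: is_ideal0.
by move=> x y; apply: is_idealD.
Qed.

Lemma ideal_gen_ideal (X : set R) : is_ideal (ideal_gen X).
Proof.
split=> [J [[J0 _] _] //|a x y Xx Xy J [idJ XJ]].
by case: idJ (Xx J (conj idJ XJ)) (Xy J (conj idJ XJ)) => _; apply.
Qed.

Lemma ideal_gen_min (X J : set R) :
  is_ideal J -> X `<=` J -> ideal_gen X `<=` J.
Proof. by move=> idJ XJ x; apply; split. Qed.

Lemma sub_ideal_gen (X : set R) : X `<=` ideal_gen X.
Proof. by move=> x Xx J [_]; apply. Qed.

Lemma ideal_exp_ideal I n : is_ideal (ideal_exp I n).
Proof. by case: n => [|n] //; apply: ideal_gen_ideal. Qed.

Lemma ideal_expS I n x y : I x -> ideal_exp I n y -> ideal_exp I n.+1 (x * y).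
Proof. by move=> Ix Iy; apply: sub_ideal_gen; exists x => //; exists y. Qed.

Lemma ideal_expS_ind I n J : is_ideal J ->
  (forall x y, I x -> ideal_exp I n y -> J (x * y)) -> ideal_exp I n.+1 `<=` J.
Proof.
by move=> idJ IJ; apply: ideal_gen_min => // _ [x Ix [y Iy <-]]; apply: IJ.
Qed.

Lemma ideal_exp1 I : is_ideal I -> ideal_exp I 1 = I.
Proof.
move=> idI; rewrite eqEsubset; split.
  by apply: ideal_expS_ind => // x y Ix _; apply: is_idealMr.
by move=> x Ix; rewrite -[x]mulr1; apply: ideal_expS.
Qed.

Lemma ideal_exp_sub I n : ideal_exp I n.+1 `<=` ideal_exp I n.
Proof.
apply: ideal_expS_ind => [|x y _]; first exact: ideal_exp_ideal.
by apply: is_idealMl; apply: ideal_exp_ideal.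
Qed.

Lemma ideal_expD I m n x y :
  ideal_exp I m x -> ideal_exp I n y -> ideal_exp I (m + n)%N (x * y).
Proof.
move=> Ix Iy; elim: m x Ix => [x _|m IHm x Ix].
  exact: (is_idealMl _ (ideal_exp_ideal _ _)).
pose J := [set x | ideal_exp I (m.+1 + n)%N (x * y)].
move: x Ix; apply: (ideal_expS_ind (J := J)).
  rewrite /J; split=> /= [|a x z Ix Iz].
    by rewrite mul0r; exact: (is_ideal0 (ideal_exp_ideal _ _)).
  rewrite mulrDl -mulrA; apply: (is_idealD (ideal_exp_ideal _ _)) => //.
    exact: (is_idealMl _ (ideal_exp_ideal _ _)).
by move=> a b Ia Ib; rewrite /J /= -mulrA; apply: ideal_expS => //; apply: IHm.
Qed.

Definition is_prime I :=
  [/\ is_ideal I, ~ I 1 & forall x y, I (x * y) -> I x \/ I y].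

(** The contraction of I^n R_I to R when I is prime; avoiding fractions makes it
available at once for the polynomial rings and for R. *)
Definition sat_power I n : set R :=
  [set f | exists2 t, ~ I t & ideal_exp I n (t * f)].

End IdealPowers.

Section SaturatedPowers.
Variables (R : comPzRingType) (I : set R).
Hypothesis primeI : is_prime I.
Let idI : is_ideal I. Proof. by case: primeI. Qed.

Lemma prime_memM x y : ~ I x -> I (x * y) -> I y.
Proof. by case: primeI => _ _ IM nIx /IM[]. Qed.

Lemma prime_nmemM x y : ~ I x -> ~ I y -> ~ I (x * y).
Proof. by move=> nIx nIy /(prime_memM nIx). Qed.

Lemma sub_sat_power n : ideal_exp I n `<=` sat_power I n.
Proof. by move=> f If; exists 1; [case: primeI | rewrite mul1r]. Qed.

Lemma sat_power_ideal n : is_ideal (sat_power I n).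
Proof.
have idIn := ideal_exp_ideal I n.
split=> [|a x y [t nIt Ix] [u nIu Iy]]; first by apply: sub_sat_power; case: idIn.
exists (t * u); first exact: prime_nmemM.
have -> : t * u * (a * x + y) = u * a * (t * x) + t * (u * y) by ring.
by apply: is_idealD => //; apply: is_idealMl.
Qed.

Lemma sat_power_cancel n t f : ~ I t -> sat_power I n (t * f) -> sat_power I n f.
Proof.
move=> nIt [u nIu Itf]; exists (u * t); first exact: prime_nmemM.
by rewrite -mulrA.
Qed.

Lemma sat_powerD m n x y :
  ideal_exp I m x -> sat_power I n y -> sat_power I (m + n)%N (x * y).
Proof.
move=> Ix [t nIt Iy]; exists t => //; rewrite mulrCA.
exact: ideal_expD.
Qed.

Lemma sat_powerS n x y : I x -> sat_power I n y -> sat_power I n.+1 (x * y).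
Proof. by move=> Ix; apply: (@sat_powerD 1); rewrite ideal_exp1. Qed.

Lemma sat_power1 : sat_power I 1 = I.
Proof.
rewrite eqEsubset; split=> [f|f If]; last first.
  by apply: sub_sat_power; rewrite ideal_exp1.
by case=> t nIt; rewrite ideal_exp1 //; apply: prime_memM.
Qed.

End SaturatedPowers.

Section Preimage.
Variables (R S : comPzRingType) (f : {rmorphism R -> S}) (I : set R) (J : set S).
Hypothesis IJ : forall x, I x <-> J (f x).

Lemma is_prime_preimage : is_prime J -> is_prime I.
Proof.
case=> -[J0 JP] J1 JM; split=> [|/IJ|x y /IJ].
- split=> [|a x y /IJ Ix /IJ Iy]; apply/IJ; rewrite ?rmorph0 //.
  by rewrite rmorphD rmorphM; apply: JP.
- by rewrite rmorph1.
- by rewrite rmorphM => /JM[] /IJ; [left | right].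
Qed.

Lemma sub_sat_power_rmorph n x : sat_power I n x -> sat_power J n (f x).
Proof.
have expf : ideal_exp I n `<=` [set y | ideal_exp J n (f y)].
  elim: n => [//|n IHn]; apply: ideal_expS_ind => [|a b /IJ Ja Ib].
    have [J0 JP] := ideal_exp_ideal J n.+1.
    split=> [|a b c Jb Jc]; rewrite /= ?rmorph0 //.
    by rewrite rmorphD rmorphM; apply: JP.
  by rewrite /= rmorphM; apply: ideal_expS => //; apply: IHn.
move=> [t nIt Itx]; exists (f t); first by move/IJ.
by rewrite -rmorphM; apply: expf.
Qed.

End Preimage.

(** * Symbolic powers as saturated powers *)

Lemma prime_idealr_is_prime (R : comNzRingType) (Q : prime_idealr R) :
  is_prime [set x | x \in Q].
Proof.
split=> [|/=|x y /=]; last by rewrite prime_idealrM => /orP.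
  split=> /= [|a x y Qx Qy]; first exact: rpred0.
  by rewrite rpredD // idealMr.
by rewrite idealr1.
Qed.

Lemma to_loc_inv (R : comPzRingType) (W : mulrClosed R) (t : R) (Wt : t \in W)
    (f : R) :
  (\pi_(localization W)%qT (mk_rep 1 Wt) : localization W) * to_loc W (t * f) =
  to_loc W f.
Proof.
transitivity (locM (\pi_(localization W)%qT (mk_rep 1 Wt)) (to_loc W (t * f))).
  by [].
rewrite /to_loc locME; apply: loc_eq1 => /=.
by rewrite /loc_den /= !mulr1 mul1r mulrC.
Qed.

Lemma symbolic_powerE (R : comNzRingType) (Q : prime_idealr R) n :
  symbolic_power Q n = sat_power [set x | x \in Q] n.
Proof.
set W : mulrClosed R := prime_compl Q.
set I := [set x | x \in Q].
have primeI : is_prime I := prime_idealr_is_prime Q.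
have idIn := ideal_exp_ideal I n.
rewrite eqEsubset; split=> f /=; rewrite /symbolic_power -/I /=.
  (* The fractions with numerator in Q^n form an ideal: it is all of Q^n R_Q. *)
  pose J : set (localization W) :=
    [set z | exists x, z = \pi_(localization W)%qT x /\ ideal_exp I n x.1].
  have /ideal_gen_min/[apply] : is_ideal J.
    split=> [|a _ _ [x [-> Ix]] [y [-> Iy]]].
      by exists (rep0 W); split=> //; apply: is_ideal0.
    elim/quotW: a => a.
    exists (repD (repM a x) y); split=> /=; last first.
      by apply: is_idealD => //; apply: is_idealMr => //; apply: is_idealMl.
    by rewrite -locDE -locME.
  case=> [_ [x Ix <-]|x [/loc_eqP[w Ww e] Ix]].
    by exists (mk_rep x (rpred1 W)).
  exists (w * loc_den x).
    by apply: (prime_nmemM primeI); apply/negP => //; exact: (loc_denP x).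
  move: e; rewrite /= {2}/loc_den /= mulr1 => e.
  by rewrite -mulrA [_ * f]mulrC e; apply: is_idealMl.
case=> t nIt Itf.
have Wt : t \in W by apply/negP.
rewrite -(to_loc_inv Wt f) -[_ * _]addr0.
case: (ideal_gen_ideal [set to_loc W x | x in ideal_exp I n]) => g0 gP.
by apply: gP => //; apply: sub_ideal_gen; exists (t * f).
Qed.

(** * Derivations and Euler fields *)

Section Derivations.
Variables (A P : comPzRingType) (iota : A -> P).

Definition is_derivation (d : P -> P) :=
  [/\ {morph d : x y / x + y}, forall x y, d (x * y) = d x * y + x * d y
    & forall a, d (iota a) = 0].

Lemma derivation0 d : is_derivation d -> d 0 = 0.
Proof. by case=> dD _ _; apply: (addrI (d 0)); rewrite -dD !addr0. Qed.

Lemma derivation_comb k (y : nat -> P) (d : nat -> P -> P) :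
  (forall i, is_derivation (d i)) ->
  is_derivation (fun x => \sum_(i < k) y i * d i x).
Proof.
move=> dP; split=> [a b|a b|a].
- by rewrite -big_split; apply: eq_bigr => i _ /=; have [-> _ _] := dP i; ring.
- rewrite mulr_suml mulr_sumr -big_split; apply: eq_bigr => i _ /=.
  by have [_ -> _] := dP i; ring.
by apply: big1 => i _; have [_ _ ->] := dP i; rewrite mulr0.
Qed.

(** The combination E of the d_i with coefficients y_i in I acts on I / I^(2) as
multiplication by s, a unit of the local ring at I.  Keeping the y_i and the d_i
apart, rather than E alone, matters twice: they are what descends from a
polynomial ring to R, and bounding E f needs that each single d_i f lies in a
power of I.  The functions y and d are total on nat so that prepending a term is
a plain case analysis; only the terms below k enter the sum. *)
Definition is_euler (I : set P) k (y : nat -> P) (d : nat -> P -> P) s :=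
  [/\ ~ I s, forall i, I (y i), forall i, is_derivation (d i)
    & forall x, I x -> sat_power I 2 (\sum_(i < k) y i * d i x - s * x)].

(** Leibniz: if E x = s x modulo I^(2) on I, then E multiplies a product of m
elements of I by m s modulo I^(m+1).  A multiplier a of such a product only
contributes E(a) times an element of I^m, and E(a) is in I. *)
Lemma euler_sat_power (I : set P) (E : P -> P) s m f :
  is_prime I -> is_derivation E -> (forall x, I (E x)) ->
  (forall x, I x -> sat_power I 2 (E x - s * x)) ->
  sat_power I m f -> sat_power I m.+1 (E f - m%:R * s * f).
Proof.
move=> primeI [ED EM E0] EI Es.
have sat_id n : is_ideal (sat_power I n) by apply: sat_power_ideal.
have exp_id n : is_ideal (ideal_exp I n) by apply: ideal_exp_ideal.
have EZ x y n : sat_power I n y -> sat_power I n.+1 (E x * y).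
  exact: sat_powerS.
have expE n x : ideal_exp I n x -> sat_power I n.+1 (E x - n%:R * s * x).
  elim: n x => [|n IHn] x Ix; first by rewrite !mul0r subr0 sat_power1.
  pose J := [set z | ideal_exp I n.+1 z /\
                     sat_power I n.+2 (E z - n.+1%:R * s * z)].
  suff /(_ x Ix)[] : ideal_exp I n.+1 `<=` J by [].
  apply: ideal_expS_ind => [|{Ix} x y Ix Iy].
    split=> [|a {Ix} x y [Ix Sx] [Iy Sy]].
      split; first exact: is_ideal0.
      have -> : E 0 = 0 by apply: (@derivation0 E); split.
      by rewrite mulr0 subr0; apply: is_ideal0.
    split.
      by apply: (is_idealD (exp_id _)) => //; apply: (is_idealMl _ (exp_id _)).
    rewrite ED EM.
    have -> : E a * x + a * E x + E y - n.+1%:R * s * (a * x + y) =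
      E a * x + (a * (E x - n.+1%:R * s * x) + (E y - n.+1%:R * s * y)) by ring.
    apply: (is_idealD (sat_id _)) => //; first exact/EZ/sub_sat_power.
    by apply: (is_idealD (sat_id _)) => //; apply: (is_idealMl _ (sat_id _)).
  split; first exact: ideal_expS.
  have -> : E (x * y) - n.+1%:R * s * (x * y) =
     x * (E y - n%:R * s * y) + y * (E x - s * x) by rewrite EM -natr1; ring.
  apply: (is_idealD (sat_id _)) => //; first exact/sat_powerS/IHn.
  by rewrite -addn2; apply: sat_powerD => //; apply: Es.
case=> t nIt Itf; apply: (sat_power_cancel primeI nIt).
have -> : t * (E f - m%:R * s * f) =
    (E (t * f) - m%:R * s * (t * f)) - E t * f by rewrite EM; ring.
by apply: (is_idealB (sat_id _)) => //; [apply: expE | apply: EZ; exists t].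
Qed.

End Derivations.

(** * Differential operators *)

Section DifferentialOperators.
Variables (A : comPzRingType) (R : comAlgType A).
Implicit Types d : R -> R.

Lemma diff_op_mul f : diff_op 0 (fun x : R => f * x).
Proof. by exists f. Qed.

Lemma diff_op_linear n d : diff_op n d -> linear d.
Proof.
case: n => [[f df] a x y|n []//].
by rewrite !df mulrDr scalerAr.
Qed.

Lemma diff_op_leqS n d : diff_op n d -> diff_op n.+1 d.
Proof.
elim: n d => [|n IHn] d dn; (split; first exact: diff_op_linear dn) => f.
  move: dn => [g dg]; exists 0 => x; rewrite !dg mul0r.
  by rewrite mulrCA subrr.
by apply: IHn; case: dn => _; apply.
Qed.

Lemma diff_opD n d e :
  diff_op n d -> diff_op n e -> diff_op n (fun x => d x + e x).
Proof.
elim: n d e => [|n IHn] d e.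
  by move=> [f df] [g eg]; exists (f + g) => x; rewrite df eg mulrDl.
move=> dn en; split=> [a x y|f].
  rewrite (diff_op_linear dn) (diff_op_linear en) scalerDr addrACA //.
rewrite (_ : (fun x => _) =
    fun x => (d (f * x) - f * d x) + (e (f * x) - f * e x)).
  by apply: IHn; [case: dn => _; apply | case: en => _; apply].
by apply/funext => x; ring.
Qed.

Lemma diff_op_mulr n d g : diff_op n d -> diff_op n (fun x => d (g * x)).
Proof.
elim: n d => [d [f df]|n IHn d dn].
  by exists (f * g) => x; rewrite df mulrA.
split=> [a x y|f]; first by rewrite -(diff_op_linear dn) mulrDr scalerAr.
rewrite (_ : (fun x => _) = fun x => (fun z => d (f * z) - f * d z) (g * x)).
  by apply: (IHn (fun z => d (f * z) - f * d z)); case: dn => _; apply.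
by apply/funext => x /=; rewrite mulrCA.
Qed.

Lemma derivation_linear d : is_derivation (fun a : A => a%:A : R) d -> linear d.
Proof.
case=> dD dM dA a x y.
by rewrite dD -mulr_algl dM dA mul0r add0r mulr_algl.
Qed.

(** [d e, f] = [d, f] e + d (e f), where e f acts by multiplication: the first
term is of order at most n by induction, the second because d is. *)
Lemma diff_op_derivation n d e : is_derivation (fun a : A => a%:A : R) e ->
  diff_op n d -> diff_op n.+1 (fun x => d (e x)).
Proof.
move=> eP; have [eD eM _] := eP.
have eL := derivation_linear eP.
elim: n d => [|n IHn] d dn; have dL := diff_op_linear dn.
  split=> [a x y|f]; first by rewrite eL dL.
  move: dn => [g dg]; exists (g * e f) => x.
  by rewrite !dg eM; ring.
split=> [a x y|f]; first by rewrite eL dL.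
rewrite (_ : (fun x => _) =
    fun x => (d (f * e x) - f * d (e x)) + d (e f * x)).
  apply: diff_opD; last exact: diff_op_mulr.
  by apply: (IHn (fun x => d (f * x) - f * d x)); case: dn => _; apply.
apply/funext => x; rewrite eM.
have -> : d (e f * x + f * e x) = d (e f * x) + d (f * e x).
  by have := dL 1 (e f * x) (f * e x); rewrite !scale1r.
by ring.
Qed.

Variable I : set R.
Hypothesis primeI : is_prime I.

(** For x in I and y in I^(n+1), d (x y) = [d, x] y + x d y, where [d, x] has
smaller order.  The induction carries membership in I^(n+1) along, because
closure of the claim under multiplication by a also passes through [d, a]. *)
Lemma diff_op_ideal_exp n d f : diff_op n d -> ideal_exp I n.+1 f -> I (d f).
Proof.
have [idI _ _] := primeI.
elim: n d f => [|n IHn] d f dn If.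
  case: dn => g ->; move: If; rewrite ideal_exp1 //; exact: is_idealMl.
have dL := diff_op_linear dn.
pose J := [set z | ideal_exp I n.+1 z /\ I (d z)].
have comm a x : ideal_exp I n.+1 x -> I (d (a * x) - a * d x).
  by move=> Ix; case: dn => _ dn; apply: IHn (dn a) Ix.
have idn := ideal_exp_ideal I n.+1.
suff /(_ f If)[] : ideal_exp I n.+2 `<=` J by [].
apply: ideal_expS_ind => [|x y Ix Iy].
  split=> [|a x y [Ix Idx] [Iy Idy]].
    have d0 : d 0 = 0 by have := dL (-1) 0 0; rewrite !scaleN1r !addNr.
    by split; [apply: is_ideal0 | rewrite d0; apply: is_ideal0].
  split; first by apply: (is_idealD idn) => //; apply: (is_idealMl _ idn).
  have -> : d (a * x + y) = (d (a * x) - a * d x) + (a * d x + d y).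
    by have := dL 1 (a * x) y; rewrite !scale1r => ->; ring.
  apply: is_idealD => //; first exact: comm.
  by apply: is_idealD => //; apply: is_idealMl.
split; first exact: (is_idealMl _ idn).
rewrite -[d (x * y)](subrK (x * d y)); apply: is_idealD => //; first exact: comm.
exact: is_idealMr.
Qed.

Lemma diff_op_sat_power n d f : diff_op n d -> sat_power I n.+1 f -> I (d f).
Proof.
have [idI _ _] := primeI.
move=> dn [t nIt Itf]; elim: n d dn Itf => [|n IHn] d dn Itf.
  by apply: (prime_memM primeI nIt); case: dn => g dg;
     have := diff_op_ideal_exp (diff_op_mul g) Itf; rewrite dg mulrCA.
have Idtf := diff_op_ideal_exp dn Itf.
apply: (prime_memM primeI nIt).
have -> : t * d f = d (t * f) - (d (t * f) - t * d f) by ring.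
apply: is_idealB => //; case: dn => _ /(_ t)/IHn; apply; exact: ideal_exp_sub.
Qed.

(** With f known in I^(n+1) by induction, both E f and E f - (n+1) s f lie in
I^(n+2), the former because each d_i f is again in a differential power. *)
Lemma diff_power_sub_sat_power k y (d : nat -> R -> R) s n :
  (forall m, ~ I m.+1%:R) ->
  is_euler (fun a : A => a%:A) I k y d s ->
  (diff_power I n.+1 `<=` sat_power I n.+1).
Proof.
move=> char0 [nIs yI dP Es].
have [idI _ _] := primeI.
elim: n => [|n IHn] f /= If.
  by rewrite sat_power1 //; have := If _ (diff_op_mul 1); rewrite mul1r.
have Sf : sat_power I n.+1 f by apply: IHn => e en; apply/If/diff_op_leqS.
apply: (sat_power_cancel primeI (prime_nmemM primeI (char0 n) nIs)).
have idS := sat_power_ideal primeI n.+2.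
pose E x := \sum_(i < k) y i * d i x.
have -> : n.+1%:R * s * f = E f - (E f - n.+1%:R * s * f) by ring.
apply: (is_idealB idS) => //.
  apply: (is_ideal_sum _ idS) => i _; apply: sat_powerS => //.
  by apply: IHn => e en; apply: If (diff_op_derivation (dP i) en).
apply: (euler_sat_power primeI (derivation_comb _ _ dP)) => // x.
by apply: is_ideal_sum => // i _; apply: is_idealMr.
Qed.

End DifferentialOperators.

(** * Euler fields on polynomial rings *)

Section PolynomialExtension.
Variables (A : comPzRingType) (B : idomainType) (iota : A -> B).
Variables (p : set B) (q : set {poly B}).
Hypotheses (primeq : is_prime q) (qC : forall b, p b <-> q b%:P).
Let idq : is_ideal q. Proof. by case: primeq. Qed.
Let primep : is_prime p.
Proof. exact: (is_prime_preimage (f := polyC)) qC primeq. Qed.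
Let idp : is_ideal p. Proof. by case: primep. Qed.

Let iotaX a := (iota a)%:P.

Lemma derivation_map_poly d :
  is_derivation iota d -> is_derivation iotaX (map_poly d).
Proof.
move=> dP; have [dD dM dA] := dP; have d0 := derivation0 dP.
have dE (f : {poly B}) i : (map_poly d f)`_i = d f`_i by rewrite coef_map_id0.
have dS (T : Type) (r : seq T) (F : T -> B) :
    d (\sum_(j <- r) F j) = \sum_(j <- r) d (F j).
  exact: (big_morph d dD d0).
split=> [f g|f g|a]; apply/polyP => i.
- by rewrite !(dE, coefD) dD.
- rewrite !(dE, coefD, coefM) dS -big_split; apply: eq_bigr => j _ /=.
  by rewrite dM !dE.
by rewrite dE coefC coef0; case: eqP.
Qed.

Lemma derivation_deriv : is_derivation iotaX (@deriv B).
Proof. by split=> [f g|f g|a]; rewrite ?derivD ?derivM ?derivC. Qed.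

Lemma coef_mem_ideal (f : {poly B}) : (forall i, p f`_i) -> q f.
Proof.
move=> pf; rewrite -[f]coefK poly_def; apply: is_ideal_sum => // i _.
by rewrite -mul_polyC; apply: is_idealMr => //; apply/qC.
Qed.

Section AdjoiningAVariable.
Variables (k : nat) (y : nat -> B) (d : nat -> B -> B) (s : B).
Hypothesis eulerp : is_euler iota p k y d s.

(* The given field, extended to B[X] by acting on coefficients. *)
Let Ecoef (f : {poly B}) := \sum_(i < k) (y i)%:P * map_poly (d i) f.

Lemma euler_coef (f : {poly B}) : (forall i, p f`_i) ->
  sat_power q 2 (Ecoef f - s%:P * f).
Proof.
case: eulerp => _ _ dP Es pf; rewrite -[Ecoef f - _]coefK poly_def.
apply: (is_ideal_sum _ (sat_power_ideal primeq 2)) => i _.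
rewrite -mul_polyC; apply: (is_idealMr _ (sat_power_ideal primeq 2)).
apply: (sub_sat_power_rmorph (f := polyC) qC); rewrite coefB coefCM coef_sum.
under eq_bigr => j _ do rewrite coefCM coef_map_id0 ?(derivation0 (dP j)) //.
exact: Es.
Qed.

Lemma Ecoef_mem f : q (Ecoef f).
Proof.
case: eulerp => _ yp _ _; apply: is_ideal_sum => // i _.
by apply: is_idealMr => //; apply/qC.
Qed.

(** The hypothesis says that q = p B[X], i.e. that the class of X is
transcendental over the residue field of p. *)
Lemma euler_poly_transcendental :
  (forall f, q f -> forall i, p f`_i) ->
  is_euler iotaX q k (fun i => (y i)%:P) (fun i => map_poly (d i)) s%:P.
Proof.
case: (eulerp) => nps yp dP _ qp; split=> [/qC //|i|i|f /qp].
- exact/qC.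
- exact: derivation_map_poly.
- exact: euler_coef.
Qed.

Hypothesis char0 : forall m, ~ p m.+1%:R.

(** Modulo p, g is a minimal polynomial of the class of X.  The field
g' E + (s g - E g) d/dX, with E acting on coefficients, sends g exactly to
g' s g, and agrees with g' E on p B[X] modulo q^(2), since there the
d/dX-term is a product of two elements of q.  Pseudo-division by g reduces
every element of q to these two cases. *)
Lemma euler_poly_algebraic g :
  q g -> ~ p (lead_coef g) ->
  (forall f, q f -> (size f < size g)%N -> forall i, p f`_i) ->
  is_euler iotaX q k.+1
    (fun i => if i is j.+1 then g^`() * (y j)%:P else s%:P * g - Ecoef g)
    (fun i => if i is j.+1 then map_poly (d j) else @deriv B)
    (g^`() * s%:P).
Proof.
move=> qg npg gmin; case: (eulerp) => nps yp dP _.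
have sg : (1 < size g)%N.
  rewrite ltnNge; apply/negP => /size1_polyC gC; apply: npg.
  by rewrite gC lead_coefC; apply/qC; rewrite -gC.
(* The leading coefficient of g' is deg g times that of g. *)
have nqg' : ~ q g^`().
  move=> /gmin; rewrite lt_size_deriv -?size_poly_gt0 ?(ltnW sg) //.
  move=> /(_ isT (size g).-2); rewrite coef_deriv.
  have -> : (size g).-2.+1 = (size g).-1 by case: (size g) sg => [|[]].
  rewrite -mulr_natl -/(lead_coef g); case: (size g) sg => [|[|m]] // _.
  by move=> /(prime_memM primep (@char0 m)).
have idS := sat_power_ideal primeq 2.
pose F f := \sum_(i < k.+1)
   (if val i is j.+1 then g^`() * (y j)%:P else s%:P * g - Ecoef g) *
   (if val i is j.+1 then map_poly (d j) else @deriv B) f.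
have EE f : F f = (s%:P * g - Ecoef g) * f^`() + g^`() * Ecoef f.
  rewrite /F big_ord_recl /= mulr_sumr; congr (_ + _).
  by apply: eq_bigr => i _; rewrite mulrA.
have yq i : q (if i is j.+1 then g^`() * (y j)%:P else s%:P * g - Ecoef g).
  case: i => [|j]; last by apply: is_idealMl => //; apply/qC.
  by apply: is_idealB => //; [apply: is_idealMl | apply: Ecoef_mem].
have dder i :
    is_derivation iotaX (if i is j.+1 then map_poly (d j) else @deriv B).
  by case: i => [|j]; [apply: derivation_deriv | apply: derivation_map_poly].
have [ED EM _] : is_derivation iotaX F.
  exact: (derivation_comb k.+1 (fun i =>
    if i is j.+1 then g^`() * (y j)%:P else s%:P * g - Ecoef g) dder).
have Eq f : q (F f) by apply: is_ideal_sum => // i _; apply: is_idealMr.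
split=> // [|f qf]; first by apply: prime_nmemM => // /qC.
rewrite -/(F f).
have Eg : F g = g^`() * s%:P * g by rewrite EE; ring.
have q2 a b : q a -> q b -> sat_power q 2 (a * b).
  by move=> qa qb; apply: sat_powerS => //; rewrite sat_power1.
have Ep (r : {poly B}) : (forall i, p r`_i) ->
    sat_power q 2 (F r - g^`() * s%:P * r).
  move=> pr.
  have -> : F r - g^`() * s%:P * r =
      (s%:P * g - Ecoef g) * r^`() + g^`() * (Ecoef r - s%:P * r).
    by rewrite EE; ring.
  apply: (is_idealD idS); last by apply: (is_idealMl _ idS); apply: euler_coef.
  apply: q2; first exact: (yq 0%N).
  apply: coef_mem_ideal => i; rewrite coef_deriv -mulr_natr.
  by apply: is_idealMr.
have g0 : g != 0 by rewrite -size_poly_gt0 ltnW.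
set c : B := lead_coef g ^+ scalp f g.
have cf : c%:P * f = f %/ g * g + f %% g.
  by rewrite mul_polyC -Pdiv.Idomain.divp_eq.
have nqc : ~ q c%:P.
  move=> /qC; rewrite /c; elim: (scalp f g) => [|n IHn].
    by case: primep.
  by rewrite exprS => /(prime_memM primep npg).
have qr : q (f %% g).
  have -> : f %% g = c%:P * f - f %/ g * g by rewrite cf; ring.
  by apply: is_idealB => //; apply: is_idealMl.
apply: (sat_power_cancel primeq nqc).
have -> : c%:P * (F f - g^`() * s%:P * f) =
    F (f %/ g) * g + (F (f %% g) - g^`() * s%:P * (f %% g)) - F c%:P * f.
  have -> : c%:P * (F f - g^`() * s%:P * f) =
      F (c%:P * f) - g^`() * s%:P * (c%:P * f) - F c%:P * f.
    by rewrite EM; ring.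
  by rewrite cf ED EM Eg; ring.
apply: (is_idealB idS); last exact: q2.
apply: (is_idealD idS); first exact: q2.
by apply: Ep; apply: gmin; rewrite // ltn_modp.
Qed.
End AdjoiningAVariable.

(** In the algebraic case, g has minimal size among the polynomials of q with a
coefficient outside p; minimality forces its leading coefficient outside p. *)
Lemma euler_poly : (forall m, ~ p m.+1%:R) ->
  (exists k y d s, is_euler iota p k y d s) ->
  exists k y d s, is_euler iotaX q k y d s.
Proof.
move=> char0 [k [y [d [s eulerp]]]].
have [qp|] := pselect (forall f : {poly B}, q f -> forall i, p f`_i).
  by do 4!eexists; apply: euler_poly_transcendental eulerp qp.
move/existsNP => [f0 /not_implyP[qf0 /existsNP npf0]].
pose bad n := `[< exists f : {poly B},
  [/\ q f, exists i, ~ p f`_i & size f = n] >].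
have ex_bad : exists n, bad n by exists (size f0); apply/asboolP; exists f0.
case: (ex_minnP ex_bad) => _ /asboolP[g [qg [i npgi] <-]] gmin.
have {}gmin (f : {poly B}) : q f -> (size f < size g)%N -> forall j, p f`_j.
  move=> qf fg j; apply: contrapT => npfj.
  move: fg; rewrite ltnNge => /negP; apply.
  by apply: gmin; apply/asboolP; exists f; split=> //; exists j.
do 4!eexists; apply: (euler_poly_algebraic eulerp char0 qg _ gmin) => plg.
have g0 : (0 < size g)%N.
  rewrite lt0n size_poly_eq0; apply/eqP => g0; apply: npgi.
  by rewrite g0 coef0; case: idp.
(* Otherwise the leading term is in q, and removing it gives a smaller g. *)
pose lead := (lead_coef g)%:P * 'X^((size g).-1).
have leadE j : lead`_j = if j == (size g).-1 then lead_coef g else 0.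
  by rewrite coefCM coefXn; case: eqP; rewrite ?mulr1 ?mulr0.
apply: npgi; have := gmin (g - lead) _ _ i; rewrite coefB leadE.
case: eqP => [-> _ //|_]; rewrite subr0; apply.
  by apply: is_idealB => //; apply: is_idealMr => //; apply/qC.
rewrite -(prednK g0) ltnS; apply/leq_sizeP => j; rewrite leq_eqVlt.
rewrite coefB leadE eq_sym => /orP[/eqP ->|gj]; first by rewrite eqxx subrr.
rewrite gtn_eqF // subr0 nth_default //; move: gj.
by rewrite -(ltn_predK g0).
Qed.

End PolynomialExtension.

(** P is an iterated polynomial ring over A, one variable for each entry of l.
It enters only through these properties, so it is kept abstract. *)
Lemma euler_presentation (A : idomainType) (R : comNzRingType)
    (phi : {rmorphism A -> R}) (I : set R) (l : seq R) :
  is_prime I -> (forall a, I (phi a) -> a = 0) -> (forall m, ~ I m.+1%:R) ->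
  exists (P : idomainType) (iota : {rmorphism A -> P}) (pi : {rmorphism P -> R}),
    [/\ forall a, pi (iota a) = phi a, forall x, x \in l -> exists z, pi z = x
      & exists k y d s, is_euler iota (pi @^-1` I) k y d s].
Proof.
move=> primeI phiI char0; elim: l => [|x l [P [iota [pi [piE lP eulerP]]]]].
  exists A, idfun, phi; split=> //.
  exists 0%N, (fun=> 0), (fun _ _ => 0), 1; split=> [|_|i|a Ia] /=.
  - by rewrite /= rmorph1; case: primeI.
  - by rewrite /= rmorph0; case: primeI => -[].
  - by split=> [a b|a b|a] /=; rewrite ?mulr0 ?mul0r ?addr0.
  rewrite big_ord0 (phiI _ Ia) mulr0 subr0.
  apply: is_ideal0; apply: sat_power_ideal.
  exact: (is_prime_preimage (f := phi) (fun=> iff_refl _) primeI).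
have cx : commr_rmorph pi x by move=> z; apply: mulrC.
exists {poly P}, (polyC \o iota), (horner_morph cx); split=> [a|z|].
- by rewrite /= horner_morphC.
- rewrite inE => /predU1P[->|/lP[w wz]].
    by exists 'X; rewrite /= horner_morphX.
  by exists w%:P; rewrite /= horner_morphC.
apply: (@euler_poly A P iota (pi @^-1` I)) => [|b|m|//].
- apply: (is_prime_preimage (f := horner_morph cx) _ primeI) => f.
  exact: iff_refl.
- by rewrite /= horner_morphC.
- by rewrite /= rmorph_nat; apply: char0.
Qed.

(** * Trivial square-zero extensions *)

Section TrivialExtension.
Variables (A : comPzRingType) (R : comAlgType A) (M : lmodType R).

(** An alias of R * M, to which no componentwise multiplication can attach. *)
Definition triv_ext : Type := (R * M)%type.
HB.instance Definition _ := GRing.Zmodule.on triv_ext.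

Definition triv_one : triv_ext := (1, 0).
Definition triv_mul (x y : triv_ext) : triv_ext :=
  (x.1 * y.1, x.1 *: y.2 + y.1 *: x.2).
Definition triv_scale (a : A) (x : triv_ext) : triv_ext :=
  (a *: x.1, a%:A *: x.2).

Fact triv_mulA : associative triv_mul.
Proof.
case=> a u [b v] [c w]; rewrite /triv_mul /=; congr (_, _); first exact: mulrA.
by rewrite !scalerDr !scalerA addrA [c * a]mulrC [c * b]mulrC.
Qed.
Fact triv_mulC : commutative triv_mul.
Proof. by case=> a u [b v]; rewrite /triv_mul /= addrC mulrC. Qed.
Fact triv_mul1 : left_id triv_one triv_mul.
Proof. by case=> a u; rewrite /triv_mul /= mul1r scale1r scaler0 addr0. Qed.
Fact triv_mulDl : left_distributive triv_mul +%R.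
Proof.
case=> a u [b v] [c w]; rewrite /triv_mul /=; congr (_, _); first exact: mulrDl.
by rewrite /= scalerDl scalerDr addrACA.
Qed.
Fact triv_oner_neq0 : triv_one != 0.
Proof. by rewrite xpair_eqE /= oner_eq0. Qed.
HB.instance Definition _ := GRing.Zmodule_isComNzRing.Build triv_ext
  triv_mulA triv_mulC triv_mul1 triv_mulDl triv_oner_neq0.

Fact triv_scaleA a b x : triv_scale a (triv_scale b x) = triv_scale (a * b) x.
Proof.
by case: x => c u; rewrite /triv_scale /= !scalerA mulr_algl scalerA.
Qed.
Fact triv_scale1 : left_id 1 triv_scale.
Proof. by case=> a u; rewrite /triv_scale /= !scale1r. Qed.
Fact triv_scaleDr : right_distributive triv_scale +%R.
Proof. by move=> a [b u] [c v]; rewrite /triv_scale /= !scalerDr. Qed.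
Fact triv_scaleDl x : {morph triv_scale^~ x : a b / a + b}.
Proof. by move=> a b; rewrite /triv_scale /= !scalerDl. Qed.
HB.instance Definition _ := GRing.Zmodule_isLmodule.Build A triv_ext
  triv_scaleA triv_scale1 triv_scaleDr triv_scaleDl.

Fact triv_scaleAl (a : A) (x y : triv_ext) : a *: (x * y) = (a *: x) * y.
Proof.
case: x y => b u [c v]; congr (_, _) => /=; first exact: scalerAl.
by rewrite scalerDr !scalerA mulr_algl mulrC.
Qed.
HB.instance Definition _ := GRing.Lmodule_isLalgebra.Build A triv_ext triv_scaleAl.
HB.instance Definition _ := GRing.Lalgebra_isComAlgebra.Build A triv_ext.

Lemma triv_mulE (x y : triv_ext) : x * y = (x.1 * y.1, x.1 *: y.2 + y.1 *: x.2).
Proof. by []. Qed.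

End TrivialExtension.

(** * Descending derivations along a formally smooth quotient *)

Section JetAlgebra.
Variables (A : comPzRingType) (R : comAlgType A) (P : comNzRingType).
Variables (iota : {rmorphism A -> P}) (pi : {rmorphism P -> R}).
Hypothesis piE : forall a, pi (iota a) = a%:A.
Variables (k : nat) (d : nat -> P -> P).
Hypothesis dP : forall i, is_derivation iota (d i).

Definition jet (p : P) : triv_ext 'rV[R]_k := (pi p, \row_i pi (d i p)).

Lemma jetD p q : jet (p + q) = jet p + jet q.
Proof.
congr (_, _); first exact: rmorphD.
by apply/rowP => i; rewrite !mxE; have [-> _ _] := dP i; rewrite rmorphD.
Qed.

Lemma jetM p q : jet (p * q) = jet p * jet q.
Proof.
congr (_, _); first exact: rmorphM.
apply/rowP => i; rewrite !mxE; have [_ -> _] := dP i.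
by rewrite rmorphD !rmorphM addrC [pi (d i p) * _]mulrC.
Qed.

Lemma jet_iota a : jet (iota a) = a%:A.
Proof.
congr (_, _); first exact: piE.
apply/rowP => i; rewrite !mxE; have [_ _ ->] := dP i.
by rewrite rmorph0 mulr0.
Qed.

(** The fractions jet p / jet v for pi v a unit of R, described by cross
multiplication; jet v is then a unit of the trivial extension. *)
Definition jet_frac : {pred triv_ext 'rV[R]_k} :=
  [pred c | `[< exists p v u, u * pi v = 1 /\ c * jet v = jet p >]].

Fact jet_frac_subalg_closed : subalg_closed jet_frac.
Proof.
split=> [|a x y /asboolP[p [v [u [uv xv]]]] /asboolP[q [w [t [tw yw]]]]|
          x y /asboolP[p [v [u [uv xv]]]] /asboolP[q [w [t [tw yw]]]]];
  apply/asboolP.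
- by exists 1, 1, 1; rewrite rmorph1 mulr1 mul1r.
- exists (iota a * p * w + q * v), (v * w), (u * t).
  rewrite rmorphM mulrACA uv tw mulr1; split=> //.
  rewrite jetD !jetM jet_iota mulr_algl -xv -yw mulrDl.
  by rewrite -!scalerAl !mulrA -[y * _ * _]mulrA [jet v * _]mulrC mulrA.
exists (p * q), (v * w), (u * t); rewrite rmorphM mulrACA uv tw mulr1.
by rewrite !jetM mulrACA xv yw.
Qed.
HB.instance Definition _ := GRing.isSubalgClosed.Build A _ jet_frac
  jet_frac_subalg_closed.

Record jet_alg : Type :=
  JetAlg { jet_val : triv_ext 'rV[R]_k; _ : jet_val \in jet_frac }.
HB.instance Definition _ := [isSub for jet_val].
HB.instance Definition _ := [Choice of jet_alg by <:].
HB.instance Definition _ := [SubChoice_isSubComNzRing of jet_alg by <:].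
HB.instance Definition _ := [SubZmodule_isSubLmodule of jet_alg by <:].
HB.instance Definition _ := [SubNzRing_SubLmodule_isSubLalgebra of jet_alg by <:].
HB.instance Definition _ := [SubLalgebra_isSubAlgebra of jet_alg by <:].

Definition jet_base (c : jet_alg) : R := (val c).1.

Fact jet_base_is_zmod_morphism : zmod_morphism jet_base.
Proof. by move=> x y; rewrite /jet_base rmorphB. Qed.
Fact jet_base_is_monoid_morphism : monoid_morphism jet_base.
Proof. by split=> [|x y]; rewrite /jet_base ?rmorph1 ?rmorphM. Qed.
Fact jet_base_is_scalable : scalable jet_base.
Proof. by move=> a x; rewrite /jet_base linearZ. Qed.
HB.instance Definition _ := GRing.isZmodMorphism.Build jet_alg R jet_base
  jet_base_is_zmod_morphism.
HB.instance Definition _ := GRing.isMonoidMorphism.Build jet_alg R jet_base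
  jet_base_is_monoid_morphism.
HB.instance Definition _ := GRing.isScalable.Build A jet_alg R *:%R jet_base
  jet_base_is_scalable.

Lemma jet_base_square_zero (x y : jet_alg) :
  jet_base x = 0 -> jet_base y = 0 -> x * y = 0.
Proof.
rewrite /jet_base => x0 y0; apply: val_inj; rewrite rmorphM rmorph0.
by rewrite triv_mulE x0 y0 mulr0 !scale0r addr0.
Qed.

Hypothesis frac : forall r : R, exists p v u, u * pi v = 1 /\ r * pi v = pi p.

Lemma jet_base_surj r : exists x, jet_base x = r.
Proof.
have [p [v [u [uv rv]]]] := frac r.
(* The inverse of jet v: the module part of 1 / (a + m) is - m / a^2. *)
pose w : triv_ext 'rV[R]_k := (u, - (u ^+ 2) *: (jet v).2).
have vw : jet v * w = 1.
  rewrite triv_mulE; congr (_, _) => /=; first by rewrite mulrC.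
  by rewrite scalerA -scalerDl mulrN mulrCA mulrA uv mul1r addNr scale0r.
have wP : jet p * w \in jet_frac.
  apply/asboolP; exists p, v, u; split=> //.
  by rewrite -mulrA [w * _]mulrC vw mulr1.
exists (JetAlg wP); rewrite /jet_base /= -rv -mulrA [pi v * u]mulrC uv.
by rewrite mulr1.
Qed.

Hypothesis smoothR : formally_smooth R.

(** The section of [jet_base] given by formal smoothness has the D_i as its
module components; multiplicativity of the section is the Leibniz rule.  The
equations tie D_i r to d_i of a numerator and a denominator of r, the same for
all i. *)
Lemma descend_derivations : exists D : nat -> R -> R,
  (forall i, is_derivation (fun a : A => a%:A : R) (D i)) /\
  forall r, exists p v, [/\ exists u, u * pi v = 1, r * pi v = pi p &
    forall i, (i < k)%N -> D i r * pi v + r * pi (d i v) = pi (d i p)].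
Proof.
have [h hP] := smoothR jet_base_surj jet_base_square_zero
  (idfun : {lrmorphism R -> R}).
have {}hP r : (val (h r)).1 = r by exact: hP.
(* Past the k components of the section, the zero derivation. *)
exists (fun i r => if insub i is Some j then (val (h r)).2 0 j else 0).
split=> [i|r].
  case: insubP => [j _ _|_]; last first.
    by split=> [a b|a b|a]; rewrite ?mul0r ?mulr0 ?addr0.
  split=> [a b|a b|a].
  - by rewrite !rmorphD mxE.
  - rewrite !rmorphM triv_mulE !mxE /= !hP addrC; congr (_ + _); exact: mulrC.
  by rewrite linearZ !rmorph1 linearZ rmorph1 /= !mxE mulr0.
have /asboolP[p [v [u [uv e]]]] := valP (h r).
exists p, v; split; first by exists u.
  by have := congr1 fst e; rewrite /= hP.
move=> i ik; rewrite insubT /=.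
have := congr1 (fun c : triv_ext 'rV[R]_k => c.2 0 (Ordinal ik)) e.
by rewrite /= !mxE hP /= addrC [pi v * _]mulrC.
Qed.

(** If r in I is represented by p / v, then v (sum_i y_i D_i r) is the image of
E p minus r times that of E v, E being the Euler field of P.  The first is the
image of s p modulo I^(2), the second lies in I^2. *)
Lemma euler_descend (I : set R) (y : nat -> P) (s : P) :
  is_prime I -> is_euler iota (pi @^-1` I) k y d s ->
  exists k y (D : nat -> R -> R) s, is_euler (fun a : A => a%:A) I k y D s.
Proof.
move=> primeI [nIs yI _ Es]; have [idI _ _] := primeI.
have [D [DP De]] := descend_derivations.
exists k, (fun i => pi (y i)), D, (pi s); split=> // r Ir.
have [p [v [[u uv] rv Dv]]] := De r.
have nIv : ~ I (pi v).
  by move=> Iv; case: primeI => _ nI1 _; apply: nI1; rewrite -uv; apply: is_idealMl.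
have idS := sat_power_ideal primeI 2.
apply: (sat_power_cancel primeI nIv).
pose E x := \sum_(i < k) y i * d i x.
have -> : pi v * (\sum_(i < k) pi (y i) * D i r - pi s * r) =
   pi (E p - s * p) - r * pi (E v).
  rewrite rmorphB rmorphM -rv /E !rmorph_sum mulrBr !mulr_sumr addrAC -sumrB.
  congr (_ - _); last by ring.
  by apply: eq_bigr => i _; rewrite !rmorphM -Dv //; ring.
have primePI : is_prime (pi @^-1` I).
  exact: (is_prime_preimage (f := pi) (fun=> iff_refl _) primeI).
apply: (is_idealB idS).
  apply: (sub_sat_power_rmorph (f := pi) (I := pi @^-1` I)) => //.
  by apply: Es; rewrite /= -rv; apply: is_idealMr.
apply: sat_powerS => //; rewrite sat_power1 // rmorph_sum.
apply: is_ideal_sum => // i _; rewrite rmorphM.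
by apply: is_idealMr => //; apply: yI.
Qed.

End JetAlgebra.

(** * Presentation of essentially smooth algebras *)

Lemma localization_fractions (A : comPzRingType) (C R : comAlgType A)
    (W : mulrClosed C) :
  localization_of R W ->
  exists f : {rmorphism C -> R}, (forall a, f a%:A = a%:A) /\
    forall r, exists c w u, u * f w = 1 /\ r * f w = f c.
Proof.
move=> [g [g' gK g'K] gA]; exists (g \o to_loc W); split=> // r.
have : exists x, r = g (\pi_(localization W)%qT x).
  by exists (repr (g' r)); rewrite reprK g'K.
case=> -[c [w Ww]] ->.
have [u uw] : exists u : localization W, u * to_loc W w = 1.
  exists (\pi_(localization W)%qT (mk_rep 1 Ww)).
  by have := to_loc_inv Ww 1; rewrite [w * 1]mulr1 rmorph1.
exists c, w, (g u); rewrite /= -!rmorphM uw rmorph1; split=> //; congr (g _).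
transitivity (locM (\pi_(localization W)%qT (c, exist _ w Ww)) (to_loc W w)).
  by [].
by rewrite /to_loc locME; apply: loc_eq1 => /=; rewrite /loc_den /= !mulr1.
Qed.

Lemma fin_gen_alg_sub_image (A : comPzRingType) (C R : comAlgType A)
    (P : comNzRingType) (iota : {rmorphism A -> P}) (pi : {rmorphism P -> R})
    (f : {rmorphism C -> R}) (l : seq C) :
  (forall a, pi (iota a) = a%:A) -> (forall a, f a%:A = a%:A) ->
  (forall S : subalgClosed C, {subset l <= S} -> forall x, x \in S) ->
  (forall x, x \in l -> exists p, pi p = f x) -> forall x, exists p, pi p = f x.
Proof.
move=> piA fA gen lP x.
pose S := [pred c | `[< exists p, pi p = f c >]].
have Sclosed : subalg_closed S.
  split=> [|a u v /asboolP[p pu] /asboolP[q qv]|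
            u v /asboolP[p pu] /asboolP[q qv]]; apply/asboolP.
  - by exists 1; rewrite !rmorph1.
  - exists (iota a * p + q).
    by rewrite -[a *: u]mulr_algl !rmorphD !rmorphM pu qv piA fA.
  by exists (p * q); rewrite !rmorphM pu qv.
pose S' : subalgClosed C := HB.pack (S : {pred C})
  (GRing.isSubalgClosed.Build A C S Sclosed).
by apply/asboolP/(gen S') => c lc; apply/asboolP/lP.
Qed.

Lemma pchar0_natr_neq0 (A : idomainType) :
  isomorphic_to_Z A \/ mixed_characteristic_dvr A ->
  forall m, m.+1%:R != 0 :> A.
Proof.
move=> [[f /bij_inj f_inj] m|[_ [_ /pcharf0P char0 _]] m]; last by rewrite char0.
by rewrite -(rmorph_nat f) -(rmorph0 f) (inj_eq f_inj) Num.Theory.pnatr_eq0.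
Qed.

(** * Symbolic and differential powers *)

Theorem theorem3p9 (A : idomainType) (R : comAlgType A) (Q : prime_idealr R)
    (n : nat) :
  isomorphic_to_Z A \/ mixed_characteristic_dvr A ->
  essentially_smooth R ->
  [set a : A | a%:A \in Q] = [set 0] ->
  (1 <= n)%N ->
  symbolic_power Q n = diff_power [set x | x \in Q] n.
Proof.
move=> hA [_ smoothR [C [W [[l genC] /localization_fractions[f [fA fracf]]]]]] QA.
case: n => // n _; rewrite symbolic_powerE.
set I := [set x | x \in Q]; have primeI : is_prime I := prime_idealr_is_prime Q.
have IA a : I a%:A -> a = 0.
  by move=> Ia; have : [set a : A | a%:A \in Q] a by []; rewrite QA.
have char0 m : ~ I m.+1%:R.
  by rewrite -scaler_nat => /IA; exact/eqP/pchar0_natr_neq0.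
rewrite eqEsubset; split=> [g Ig d dn|]; first exact: diff_op_sat_power Ig.
have [P [iota [pi [piA piP [k [y [d [s eulerP]]]]]]]] :=
  @euler_presentation A R (in_alg R) I [seq f c | c <- l] primeI IA char0.
have piC c : exists p, pi p = f c.
  apply: (fin_gen_alg_sub_image piA fA genC) => x lx.
  by apply: piP; apply: map_f.
have frac r : exists p v u, u * pi v = 1 /\ r * pi v = pi p.
  have [c [w [u [uw rw]]]] := fracf r.
  have [p pc] := piC c; have [v vw] := piC w.
  by exists p, v, u; rewrite vw pc.
have [k' [y' [D [t eulerR]]]] : exists k y (D : nat -> R -> R) s,
    is_euler (fun a : A => a%:A) I k y D s.
  by apply: (euler_descend piA _ frac smoothR primeI eulerP); case: eulerP.
exact: (diff_power_sub_sat_power primeI char0 eulerR).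
Qed.
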